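(* Let $P,Q$ be probability measures, $X\sim P$, and suppose $\mathbb{P}[\imath_{P\|Q}(X)=x]=0$ for every $x\in\mathbb{R}$. Then: (a) $\omega\mapsto\mathcal{I}_\omega(P\|Q)$ is continuously differentiable on $(0,\frac12)\cup(\frac12,1)$, its derivative $\mathcal{I}'_\omega(P\|Q)$ is non-negative on $(0,\frac12)$ and non-positive on $(\frac12,1)$, and $\lim_{\omega\uparrow\frac12}\mathcal{I}'_\omega(P\|Q) - \lim_{\omega\downarrow\frac12}\mathcal{I}'_\omega(P\|Q) = 2$; (b) for $\omega\in(0,\frac12)$, $\mathbb{F}_{P\|Q}\bigl(\log\frac{1-\omega}{\omega}\bigr) = 1-\mathcal{I}_\omega(P\|Q)-(1-\omega)\mathcal{I}'_\omega(P\|Q)$; for $\omega\in(\frac12,1)$, $\mathbb{F}_{P\|Q}\bigl(\log\frac{1-\omega}{\omega}\bigr) = -\mathcal{I}_\omega(P\|Q)-(1-\omega)\mathcal{I}'_\omega(P\|Q)$; and $\mathbb{F}_{P\|Q}(0) = -\mathcal{I}_{1/2}(P\|Q)-\frac12\lim_{\omega\downarrow\frac12}\mathcal{I}'_\omega(P\|Q)$; (c) consequently, $\{\mathcal{I}_\omega(P\|Q):\omega\in(0,\frac12]\}$ determines $\mathbb{F}_{P\|Q}$ on $[0,\infty)$ and $\{\mathcal{I}_\omega(P\|Q):\omega\in(\frac12,1)\}$ determines $\mathbb{F}_{P\|Q}$ on $(-\infty,0)$.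
   Context: $\log$ is to a fixed base $b>1$. For densities $p,q$ of $P,Q$ w.r.t. a dominating measure $\mu$, $\imath_{P\|Q}:=\log p-\log q$ (in $[-\infty,\infty]$), $\mathbb{F}_{P\|Q}(x):=\mathbb{P}[\imath_{P\|Q}(X)\le x]$ with $X\sim P$. The DeGroot statistical information is $\mathcal{I}_\omega(P\|Q):=\int q\,\phi_\omega(p/q)\,\mathrm{d}\mu$ with $\phi_\omega(t)=\min\{\omega,1-\omega\}-\min\{\omega t,1-\omega\}$, $\omega\in(0,1)$, using the $f$-divergence conventions $\phi(0):=\lim_{t\downarrow0}\phi(t)$, $0\phi(0/0)=0$, $0\phi(a/0)=a\lim_{u\to\infty}\phi(u)/u$. *)

(* Defs.v *)
From mathcomp Require Import all_boot all_order all_algebra.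
From mathcomp Require Import all_classical all_reals all_analysis.
Import Order.TTheory GRing.Theory Num.Theory numFieldNormedType.Exports.

Set Implicit Arguments.
Unset Strict Implicit.
Unset Printing Implicit Defensive.

Local Open Scope classical_set_scope.
Local Open Scope ring_scope.

Section Defs.
Context {R : realType}.

Definition logb (b x : R) : R := ln x / ln b.

(** f-divergence integrand  q * phi(p/q)  with the conventions
    phi(0) := lim_{t -> 0+} phi t,  0 phi(0/0) = 0,
    0 phi(a/0) = a lim_{u -> +oo} phi u / u. *)
Definition fdiv_integrand (phi : R -> R) (pt qt : R) : R :=
  if 0 < qt then
    (if 0 < pt then qt * phi (pt / qt) else qt * lim (phi t @[t --> 0^'+]))
  else if 0 < pt then pt * lim ((phi u / u) @[u --> +oo]) else 0.

Definition degroot_phi (w t : R) : R :=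
  Num.min w (1 - w) - Num.min (w * t) (1 - w).

Context {d : measure_display} {T : measurableType d}.

Definition prob_density (mu : {measure set T -> \bar R}) (p : T -> R) : Prop :=
  [/\ measurable_fun setT p, (forall t, 0 <= p t) & (\int[mu]_t (p t)%:E = 1)%E].

Definition prob_of (mu : {measure set T -> \bar R}) (p : T -> R) (A : set T)
  : \bar R := (\int[mu]_(t in A) (p t)%:E)%E.

(** information density  log p - log q  in [-oo, +oo], with log 0 = -oo
    (the value on {p = q = 0}, a P-null set, is taken to be -oo) *)
Definition info_dens (b : R) (p q : T -> R) (t : T) : \bar R :=
  if p t == 0 then -oo%E
  else if q t == 0 then +oo%E
  else (logb b (p t) - logb b (q t))%:E.

Definition cdf_info (b : R) (mu : {measure set T -> \bar R}) (p q : T -> R)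
  (x : R) : R :=
  fine (prob_of mu p [set t | (info_dens b p q t <= x%:E)%E]).

Definition fdiv (mu : {measure set T -> \bar R}) (phi : R -> R) (p q : T -> R)
  : \bar R := (\int[mu]_t (fdiv_integrand phi (p t) (q t))%:E)%E.

(** DeGroot statistical information I_w(P||Q) (always finite) *)
Definition degroot (mu : {measure set T -> \bar R}) (w : R) (p q : T -> R) : R :=
  fine (fdiv mu (degroot_phi w) p q).

End Defs.

(* Main.v *)
Require Import Defs.
From mathcomp Require Import all_boot all_order all_algebra.
From mathcomp Require Import all_classical all_reals all_analysis.
From mathcomp Require Import measurable_realfun ring lra.
Import Order.TTheory GRing.Theory Num.Theory numFieldNormedType.Exports.
Local Open Scope classical_set_scope.
Local Open Scope ring_scope.

Set Implicit Arguments.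
Unset Strict Implicit.
Unset Printing Implicit Defensive.

(** For 0 < w < 1 the integrand of I_w is min(w, 1-w) q - min(w p, (1-w) q), so
    I_w = min(w, 1-w) - G(w), where G(w) is the Bayes risk.  The region
    S_w = {w p <= (1-w) q} is exactly {log p - log q <= log((1-w)/w)}, hence
    A(w) := P(S_w) is the value of the cdf there; with B(w) := Q(S_w^c),
    G(w) = w A(w) + (1-w) B(w), while G(v) <= v A(w) + (1-v) B(w) for all v.
    So A - B is a supergradient of G.  Without atoms, A and B are continuous by
    dominated convergence, which makes G differentiable with G' = A - B; all the
    formulas, and A(w) = G(w) + (1-w) G'(w), follow.  At w = 1/2 the slope of G
    is recovered from I on (0, 1/2) as a one-sided limit. *)

(** * Analytic tools: supergradients, and integrals over moving sets *)

(** The two bounds are the supergradient inequalities at [v] and at [w]. They place the difference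
    quotient between [h v] and [h w], and continuity of [h] at [w] squeezes it. *)
Lemma is_derive_supergradient (R : realType) (f h : R -> R) (w : R) :
  (\forall v \near w, (v - w) * h v <= f v - f w <= (v - w) * h w) ->
  h v @[v --> w] --> h w -> is_derive w 1 f (h w).
Proof.
move=> fh hw.
have cvgf : x^-1 *: (f (x *: (1 : R) + w) - f w) @[x --> 0^'] --> h w.
  have shiftw : (x *: (1 : R) + w) @[x --> 0] --> w.
    rewrite -[X in _ --> X]add0r -[X in _ --> X + _](scale0r (1 : R)).
    by apply: cvgD; [apply: cvgZr_tmp; exact: cvg_id|exact: cvg_cst].
  apply/cvgrPdist_le => e e0.
  have near_h : \forall v \near w, `|h w - h v| <= e.
    by move/cvgrPdist_le : hw; exact.
  near=> x.
  have x0 : x != 0 by near: x; exact: nbhs_dnbhs_neq.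
  have hx : `|h w - h (x *: (1 : R) + w)| <= e.
    by near: x; apply: nbhs_dnbhs; exact: (shiftw _ near_h).
  have : (x *: (1 : R) + w - w) * h (x *: (1 : R) + w) <=
      f (x *: (1 : R) + w) - f w <= (x *: (1 : R) + w - w) * h w.
    by near: x; apply: nbhs_dnbhs; exact: (shiftw _ fh).
  rewrite addrK [_ *: 1]mulr1 in hx *.
  set D := f _ - f w; set k := h (x + w) in hx * => /andP[lo hi].
  (* As [x * h w - D] lies between 0 and [x * (h w - k)], whatever the sign of [x], no case split on
     that sign arises. *)
  have -> : h w - x^-1 * D = x^-1 * (x * h w - D) by field.
  rewrite normrM normfV ler_pdivrMl ?normr_gt0//
    (ger0_norm (x := _ - D)) ?subr_ge0//.
  have xhk : `|x * (h w - k)| <= `|x| * e by rewrite normrM ler_wpM2l.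
  apply: le_trans xhk; apply: le_trans (ler_norm _).
  rewrite mulrBr lerD2l lerN2. exact: lo.
have df : derivable f w 1 by apply/cvg_ex; exists (h w).
by split=> //; apply: cvg_lim.
Unshelve. all: by end_near. Qed.

(** Dominated convergence with bound [|f|]: at almost every point the restricted functions are
    eventually equal to their limit; where [f] vanishes they are all zero. *)
Lemma cvg_Rintegral_set d (T : measurableType d) (R : realType)
    (mu : {measure set T -> \bar R}) (f : T -> R) (S : R -> set T) (w : R) :
  mu.-integrable setT (EFin \o f) -> (forall v, measurable (S v)) ->
  {ae mu, forall t, f t != 0 -> \forall v \near w, S v t <-> S w t} ->
  \int[mu]_(t in S v) f t @[v --> w] --> \int[mu]_(t in S w) f t.
Proof.
(* Dominated convergence concerns sequences, so the limit is tested along every sequence [u] tending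
   to [w]. *)
move=> intf mS aeS; apply/(@cvg_nbhsP _ R^o) => u uw.
have mfS v : measurable_fun setT (EFin \o (f \_ (S v)) : T -> \bar R).
  rewrite -restrict_EFin; apply: (measurable_int mu).
  apply: (iffLR (integrable_mkcond _ (mS v))).
  exact: (integrableS measurableT).
have := @dominated_convergence _ _ _ mu setT measurableT
  (fun n => EFin \o (f \_ (S (u n)))) (EFin \o (f \_ (S w)))
  (fun t => `|f t|%:E) (fun n => mfS (u n)) (mfS w).
case.
- apply: filterS aeS => t St _; apply: cvg_EFin; first exact: nearW.
  rewrite /comp/=; have [f0|f0] := eqVneq (f t) 0.
    under eq_fun do rewrite patchE f0 if_same.
    by rewrite patchE f0 if_same; exact: cvg_cst.
  have ev : \forall n \near \oo, (f \_ (S (u n))) t = (f \_ (S w)) t.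
    have Su : \forall n \near \oo, S (u n) t <-> S w t := uw _ (St f0).
    apply: filterS Su => n Sn; rewrite !patchE.
    by congr (if _ then _ else _); apply/idP/idP => /set_mem/Sn/mem_set.
  exact: (@cvg_near_cst _ R^o _ _ _ _ ev).
- exact: integrable_norm intf.
- apply: aeW => t n _; rewrite /= lee_fin patchE; case: ifPn => //.
  by rewrite normr0.
move=> intS _ cvgS; rewrite Rintegral_mkcond.
under eq_fun do rewrite Rintegral_mkcond.
apply: fine_cvg; rewrite fineK; last exact: integrable_fin_num.
exact: cvgS.
Qed.

(** * The DeGroot integrand, boundary conventions included *)

Lemma lim_degroot_phi0 (R : realType) (w : R) : 0 < w < 1 ->
  lim (degroot_phi w t @[t --> 0^'+]) = Num.min w (1 - w).
Proof.
move=> /andP[w0 w1]; apply: cvg_lim => //.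
have phiE : \forall t \near (0 : R)^'+,
    Num.min w (1 - w) - w * t = degroot_phi w t.
  near=> t; rewrite /degroot_phi; congr (_ - _); apply/esym/min_idPl.
  rewrite mulrC -ler_pdivlMr//; near: t; apply: nbhs_right_ltW.
  by rewrite divr_gt0// subr_gt0.
apply: cvg_trans; first exact: near_eq_cvg phiE.
apply: cvg_at_right_filter.
rewrite -[X in _ --> X]subr0 -[X in _ --> _ - X](mulr0 w).
by apply: cvgB; [exact: cvg_cst|apply: cvgM; [exact: cvg_cst|exact: cvg_id]].
Unshelve. all: by end_near. Qed.

(** [degroot_phi w] is constant beyond [(1 - w) / w], so dividing by [u] sends it to 0. *)
Lemma lim_degroot_phi_slope (R : realType) (w : R) : 0 < w < 1 ->
  lim ((degroot_phi w u / u) @[u --> +oo]) = 0.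
Proof.
move=> /andP[w0 w1]; apply: cvg_lim => //.
apply/cvgrPdist_le => e e0; near=> u.
have u0 : 0 < u by near: u; exact: nbhs_pinfty_gt.
have uw : 1 - w <= w * u.
  rewrite mulrC -ler_pdivrMr//; near: u; apply: nbhs_pinfty_ge; exact: num_real.
rewrite sub0r normrN normrM normfV (gtr0_norm u0) ler_pdivrMr// mulrC.
rewrite /degroot_phi (min_idPr uw) -(ler_pdivrMr _ _ e0).
by near: u; apply: nbhs_pinfty_ge; exact: num_real.
Unshelve. all: by end_near. Qed.

(** The conventions fit the closed form: for [pt = 0 < qt] the minimum vanishes and the limit at 0
    remains; for [qt = 0] both terms are 0, like the slope at infinity. *)
Lemma degroot_integrandE (R : realType) (w pt qt : R) :
    0 < w < 1 -> 0 <= pt -> 0 <= qt ->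
  fdiv_integrand (degroot_phi w) pt qt =
  Num.min w (1 - w) * qt - Num.min (w * pt) ((1 - w) * qt).
Proof.
move=> w01 p0 q0; have /andP[w0 w1] := w01; rewrite /fdiv_integrand.
have w1' : 0 <= 1 - w by rewrite subr_ge0 ltW.
have wp : 0 <= w * pt by rewrite mulr_ge0// ltW.
rewrite lim_degroot_phi0// lim_degroot_phi_slope//.
have [qt0|] := ltP 0 qt; last first.
  move=> qle0; have {q0 qle0} -> : qt = 0 by apply/le_anti; rewrite q0 qle0.
  by rewrite !mulr0 (min_idPr wp) subr0 if_same.
have [pt0|] := ltP 0 pt; last first.
  move=> ple0; have {wp p0 ple0} -> : pt = 0 by apply/le_anti; rewrite p0 ple0.
  have wq : 0 <= (1 - w) * qt by rewrite mulr_ge0// ltW.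
  by rewrite mulr0 (min_idPl wq) subr0 mulrC.
rewrite /degroot_phi mulrBr mulrC; congr (_ - _).
rewrite minr_pMr// [qt * (1 - w)]mulrC; congr (Num.min _ _).
by field; rewrite gt_eqF.
Qed.

(** * Information density thresholds as comparisons of weighted densities *)

Section information_density.
Context {R : realType} {d} {T : measurableType d} (b : R).
Context (p q : T -> R) (w : R) (t : T).
Hypotheses (b1 : 1 < b) (w01 : 0 < w < 1) (p0 : 0 <= p t) (q0 : 0 <= q t).

Let logb_mono : {in Num.pos &, {mono @logb R b : x y / x <= y}}.
Proof.
by move=> x y x0 y0; rewrite /logb ler_pM2r ?invr_gt0 ?ln_gt0// ler_ln.
Qed.

Let logb_div (x y : R) : 0 < x -> 0 < y -> logb b x - logb b y = logb b (x / y).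
Proof. by move=> x0 y0; rewrite /logb -mulrBl ln_div. Qed.

(** Cross-multiplication absorbs the infinite values: [p t = 0] makes both sides true, and
    [q t = 0 < p t] makes both false. *)
Lemma info_dens_le :
  (info_dens b p q t <= (logb b ((1 - w) / w))%:E)%E =
  (w * p t <= (1 - w) * q t).
Proof.
have /andP[w0 w1] := w01; rewrite /info_dens.
have [->|pn0] := eqVneq (p t) 0.
  by rewrite leNye mulr0 mulr_ge0// subr_ge0 ltW.
have pt0 : 0 < p t by rewrite lt_def pn0.
have [->|qn0] := eqVneq (q t) 0.
  by rewrite leye_eq/= mulr0 leNgt mulr_gt0.
have qt0 : 0 < q t by rewrite lt_def qn0.
rewrite lee_fin logb_div// logb_mono ?posrE ?divr_gt0 ?subr_gt0//.
by rewrite ler_pdivrMr// mulrAC ler_pdivlMr// mulrC.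
Qed.

(** The conjunct [p t != 0] excludes points where both densities vanish: they satisfy the equation,
    but their information density is [-oo]. *)
Lemma info_dens_eq :
  info_dens b p q t = (logb b ((1 - w) / w))%:E <->
  p t != 0 /\ w * p t = (1 - w) * q t.
Proof.
have /andP[w0 w1] := w01; rewrite /info_dens.
have [->|pn0] := eqVneq (p t) 0; first by split=> // -[].
have pt0 : 0 < p t by rewrite lt_def pn0.
have [->|qn0] := eqVneq (q t) 0.
  by split=> // -[_]/eqP; rewrite mulr0 gt_eqF// mulr_gt0.
have qt0 : 0 < q t by rewrite lt_def qn0.
rewrite logb_div//; split=> [[]/eqP|[_ wpq]].
  rewrite eq_le !logb_mono ?posrE ?divr_gt0 ?subr_gt0// -eq_le.
  move=> /eqP pq; split=> //.
  by rewrite -[p t](divfK qn0) pq; field; rewrite gt_eqF.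
congr (logb b _)%:E; apply: (mulfI (lt0r_neq0 w0)).
by rewrite mulrA wpq; field; rewrite gt_eqF// qn0.
Qed.

End information_density.

(** * Integrals of probability densities *)

Lemma Rintegral_setC d (T : measurableType d) (R : realType)
    (mu : {measure set T -> \bar R}) (f : T -> R) (A : set T) :
  measurable A -> mu.-integrable setT (EFin \o f) ->
  \int[mu]_t f t = \int[mu]_(t in A) f t + \int[mu]_(t in ~` A) f t.
Proof.
move=> mA intf; rewrite -(setUv A) Rintegral_setU ?setUv//.
- exact: measurableC.
- exact/disj_setPCl.
Qed.

Section density.
Context {R : realType} {d} {T : measurableType d}.
Context {mu : {measure set T -> \bar R}} {p : T -> R}.
Hypothesis dp : prob_density mu p.

Lemma prob_density_integrable : mu.-integrable setT (EFin \o p).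
Proof.
case: dp => mp p0 intp; apply/integrableP; split; first exact/measurable_EFinP.
under eq_integral do rewrite gee0_abs ?lee_fin//.
by rewrite intp ltry.
Qed.

Lemma prob_density_Rintegral : \int[mu]_t p t = 1.
Proof. by case: dp => _ _ intp; rewrite /Rintegral intp. Qed.

Lemma prob_density_Rintegral_le1 (A : set T) : measurable A ->
  0 <= \int[mu]_(t in A) p t <= 1.
Proof.
move=> mA; have pge0 B : 0 <= \int[mu]_(t in B) p t.
  by apply: Rintegral_ge0 => t _; case: dp => _ p0 _.
rewrite pge0/= -prob_density_Rintegral (Rintegral_setC mA)//.
  by rewrite lerDl.
exact: prob_density_integrable.
Qed.

End density.

(** * Decision regions and the Bayes risk *)

Section regions.
Context {R : realType} {d} {T : measurableType d}.
Implicit Types (mu : {measure set T -> \bar R}) (p q : T -> R) (w : R).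

(** This is S_w: the points where the Bayes test with prior weight [w] on P decides for Q. The next
    two definitions are its error probabilities A and B. *)
Definition region p q w : set T := [set t | w * p t <= (1 - w) * q t].

Definition region_prob mu p q w : R := \int[mu]_(t in region p q w) p t.

Definition regionC_prob mu p q w : R := \int[mu]_(t in ~` region p q w) q t.

Definition risk_slope mu p q w : R :=
  region_prob mu p q w - regionC_prob mu p q w.

Definition bayes_risk mu p q w : R :=
  \int[mu]_t Num.min (w * p t) ((1 - w) * q t).

End regions.

Section bayes_risk.
Context {R : realType} {d} {T : measurableType d}.
Context {mu : {measure set T -> \bar R}} {p q : T -> R}.
Hypotheses (dp : prob_density mu p) (dq : prob_density mu q).
Implicit Types v w : R.

Let ip := prob_density_integrable dp.
Let iq := prob_density_integrable dq.

Lemma measurable_region w : measurable (region p q w).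
Proof.
case: dp dq => mp _ _ [mq _ _]; rewrite -[region _ _ _]setTI.
by apply: measurable_fun_le => //; exact: measurable_funM.
Qed.

Let mS := measurable_region.
Let mSC w : measurable (~` region p q w) := measurableC (mS w).

Let intZ (f : T -> R) (D : set T) (k : R) : measurable D ->
  mu.-integrable setT (EFin \o f) ->
  mu.-integrable D (EFin \o (fun t => k * f t)).
Proof.
move=> mD intf.
have : mu.-integrable D (EFin \o f) by exact: (integrableS measurableT).
by move=> /(integrableZl mD k); under eq_fun do rewrite -EFinM.
Qed.

Let int_min (D : set T) w : 0 < w < 1 -> measurable D ->
  mu.-integrable D (EFin \o (fun t => Num.min (w * p t) ((1 - w) * q t))).
Proof.
move=> /andP[w0 w1] mD; apply: (integrableS measurableT) => //.
case: dp dq => mp p0 _ [mq q0 _].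
apply: (le_integrable _ _ _ (intZ w measurableT ip)) => //.
  apply/measurable_EFinP; apply: measurable_minr; exact: measurable_funM.
move=> t _ /=; have wp : 0 <= w * p t by rewrite mulr_ge0// ltW.
have wq : 0 <= (1 - w) * q t by rewrite mulr_ge0// subr_ge0 ltW.
by rewrite lee_fin !ger0_norm// ?le_min ?wp// ge_min lexx.
Qed.

(** The minimum is [w * p t] on the region and [(1 - w) * q t] off it. *)
Lemma bayes_riskE w : 0 < w < 1 ->
  bayes_risk mu p q w =
  w * region_prob mu p q w + (1 - w) * regionC_prob mu p q w.
Proof.
move=> w01; rewrite /bayes_risk (Rintegral_setC (mS w)); last exact: int_min.
rewrite -!RintegralZl//; [|exact: (integrableS measurableT)..].
congr (_ + _); apply: eq_Rintegral => t /set_mem.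
  by move=> /min_idPl.
by move/negP; rewrite -ltNge => /ltW/min_idPr.
Qed.

(** The test for prior [w] is suboptimal for prior [v]. The bound is affine in [v] and exact at
    [v = w], hence a supporting line of the risk. *)
Lemma bayes_risk_le v w : 0 < v < 1 ->
  bayes_risk mu p q v <=
  v * region_prob mu p q w + (1 - v) * regionC_prob mu p q w.
Proof.
move=> v01; rewrite /bayes_risk (Rintegral_setC (mS w)); last exact: int_min.
rewrite -!RintegralZl//; [|exact: (integrableS measurableT)..].
by apply: lerD; apply: le_Rintegral => //;
  [exact: int_min|exact: intZ|move=> t _; rewrite ge_min lexx|
   exact: int_min|exact: intZ|move=> t _; rewrite ge_min lexx orbT].
Qed.

Lemma degrootE w : 0 < w < 1 ->
  degroot mu w p q = Num.min w (1 - w) - bayes_risk mu p q w.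
Proof.
move=> w01; case: (dp) (dq) => mp p0 _ [mq q0 _].
(* The constant is multiplied by the total mass 1 of [q], to become an integral. *)
rewrite -[X in X - _]mulr1 -[X in _ * X - _](prob_density_Rintegral dq).
rewrite -RintegralZl//.
rewrite /bayes_risk -RintegralB//; [|exact: intZ|exact: int_min].
by congr fine; apply: eq_integral => t _; rewrite degroot_integrandE.
Qed.

Context {b : R} (b1 : 1 < b).

Lemma cdf_infoE w : 0 < w < 1 ->
  cdf_info b mu p q (logb b ((1 - w) / w)) = region_prob mu p q w.
Proof.
move=> w01; case: (dp) (dq) => mp p0 _ [mq q0 _].
rewrite /cdf_info /prob_of /region_prob /Rintegral; congr (fine (integral _ _ _)).
by apply/funext => t; rewrite /region/= info_dens_le.
Qed.

Hypothesis noatom : forall x : R,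
  prob_of mu p [set t | info_dens b p q t = x%:E] = 0%E.

(** The missing atom at the log-odds of [w] makes [p] vanish almost everywhere on [N], where [p] is
    nonzero, so [N] is null for [mu] itself. Off [N], the equation forces [p t = 0] and then
    [q t = 0]. *)
Lemma region_boundary_null w : 0 < w < 1 ->
  {ae mu, forall t, w * p t = (1 - w) * q t -> p t = 0 /\ q t = 0}.
Proof.
move=> w01; have /andP[w0 w1] := w01; case: (dp) (dq) => mp p0 _ [mq q0 _].
have := noatom (logb b ((1 - w) / w)); rewrite /prob_of.
set N := [set t | _].
have NE : N = [set t | p t != 0] `&` [set t | w * p t = (1 - w) * q t].
  by apply/seteqP; split=> t /(info_dens_eq b1 w01 (p0 t) (q0 t)).
have mN : measurable N.
  (* Only inequalities between measurable functions are left, so each piece is measurable. *)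
  have -> : N = ~` [set t | p t <= 0] `&` (region p q w `&`
      [set t | (1 - w) * q t <= w * p t]).
    rewrite NE; apply/seteqP; split=> t /=.
      case=> pn0 wpq; split; last by rewrite /region/= wpq lexx.
      by apply/negP; rewrite -ltNge lt_def pn0 p0.
    move=> [/negP pn0 [wpq qwp]]; split; last by apply/le_anti/andP.
    by move: pn0; rewrite -ltNge => /lt0r_neq0.
  apply: measurableI; last apply: measurableI.
  - by apply: measurableC; rewrite -[X in measurable X]setTI;
      exact: measurable_fun_le.
  - exact: measurable_region.
  - rewrite -[X in measurable X]setTI; apply: measurable_fun_le => //;
      exact: measurable_funM.
have -> : (\int[mu]_(t in N) (p t)%:E = \int[mu]_(t in N) `|(p t)%:E|)%E.
  by apply: eq_integral => t _; rewrite gee0_abs ?lee_fin.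
move/ae_eq_integral_abs => /(_ mN).
have mpN : measurable_fun N (EFin \o p : T -> \bar R).
  by apply: measurable_funTS; exact/measurable_EFinP.
move=> /(_ mpN); apply: filterS => t /= Nt wpq.
have pt0 : p t = 0.
  apply/eqP/negPn/negP => pn0; have : N t by rewrite NE.
  by move/Nt => [] /eqP; exact/negP.
split=> //; move/eqP : wpq; rewrite pt0 mulr0 eq_sym mulf_eq0 subr_eq0.
by rewrite gt_eqF//= => /eqP.
Qed.

End bayes_risk.

(** * Differentiability of the risk and of the information without atoms *)

Section atomless.
Context {R : realType} {d} {T : measurableType d}.
Context {mu : {measure set T -> \bar R}} {p q : T -> R} {b : R}.
Hypotheses (b1 : 1 < b) (dp : prob_density mu p) (dq : prob_density mu q).
Hypothesis noatom : forall x : R,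
  prob_of mu p [set t | info_dens b p q t = x%:E] = 0%E.
Implicit Types v w : R.

(** Off the null boundary the comparison at [w] is strict, so it persists for nearby [v]. The
    disjunction serves both integrands [p] and [q]. *)
Lemma near_region w : 0 < w < 1 ->
  {ae mu, forall t, p t != 0 \/ q t != 0 ->
    \forall v \near w, region p q v t <-> region p q w t}.
Proof.
move=> w01.
apply: filterS (region_boundary_null dp dq b1 noatom w01) => t pq0 pqn0.
have cvgl : v * p t @[v --> w] --> w * p t.
  by apply: cvgM; [exact: cvg_id|exact: cvg_cst].
have cvgr : (1 - v) * q t @[v --> w] --> (1 - w) * q t.
  apply: cvgM; [|exact: cvg_cst].
  by apply: cvgB; [exact: cvg_cst|exact: cvg_id].
have cvgrl : (1 - v) * q t - v * p t @[v --> w] --> (1 - w) * q t - w * p t.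
  exact: cvgB.
have [wpq|wqp|wpq] := ltgtP (w * p t) ((1 - w) * q t).
- have : \forall v \near w, 0 < (1 - v) * q t - v * p t.
    by apply: (cvgr_gt _ cvgrl); rewrite subr_gt0.
  apply: filterS => v; rewrite subr_gt0 => vpq.
  by rewrite /region/= (ltW wpq) (ltW vpq).
- have : \forall v \near w, (1 - v) * q t - v * p t < 0.
    by apply: (cvgr_lt _ cvgrl); rewrite subr_lt0.
  apply: filterS => v; rewrite subr_lt0 => vqp.
  by rewrite /region/= !leNgt wqp vqp.
- by have [p0 q0] := pq0 wpq; move: pqn0; rewrite p0 q0 eqxx => -[].
Qed.

Lemma cvg_region_prob w : 0 < w < 1 ->
  region_prob mu p q v @[v --> w] --> region_prob mu p q w.
Proof.
move=> w01; apply: cvg_Rintegral_set.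
- exact: prob_density_integrable.
- exact: measurable_region dp dq.
- by apply: filterS (near_region w01) => t St p0; apply: St; left.
Qed.

Lemma cvg_regionC_prob w : 0 < w < 1 ->
  regionC_prob mu p q v @[v --> w] --> regionC_prob mu p q w.
Proof.
move=> w01; apply: (cvg_Rintegral_set (S := fun v => ~` region p q v)).
- exact: prob_density_integrable.
- by move=> v; apply: measurableC; exact: measurable_region dp dq _.
- apply: filterS (near_region w01) => t St q0.
  by apply: filterS (St (or_intror q0)) => v Sv; exact: not_iff_compat.
Qed.

Lemma cvg_risk_slope w : 0 < w < 1 ->
  risk_slope mu p q v @[v --> w] --> risk_slope mu p q w.
Proof.
by move=> w01; apply: cvgB; [exact: cvg_region_prob|exact: cvg_regionC_prob].
Qed.

(** Eliminates B between G = w A + (1 - w) B and the slope A - B; the formulas for the cdf rest on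
    this identity. *)
Lemma region_probE w : 0 < w < 1 ->
  region_prob mu p q w = bayes_risk mu p q w + (1 - w) * risk_slope mu p q w.
Proof. by move=> w01; rewrite bayes_riskE// /risk_slope; ring. Qed.

Lemma bayes_risk_derive w : 0 < w < 1 ->
  is_derive w 1 (bayes_risk mu p q) (risk_slope mu p q w).
Proof.
move=> w01; apply: is_derive_supergradient; last exact: cvg_risk_slope.
have : \forall v \near w, v \in `]0, 1[.
    by apply: near_in_itvoo; rewrite in_itv.
apply: filterS => v; rewrite in_itv/= => v01; rewrite /risk_slope.
(* Exchanging the roles of [v] and [w] gives the upper and the lower supergradient bound. *)
have := bayes_risk_le dp dq w v01; have := bayes_risk_le dp dq v w01.
rewrite !bayes_riskE//.
by move=> h1 h2; apply/andP; split; lra.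
Qed.

(** Near such [w] the term [Num.min v (1 - v)] is [v], contributing slope 1; above one half it is
    [1 - v], contributing slope -1. *)
Lemma degroot_derive_lt w : 0 < w < 1/2 ->
  is_derive w 1 (fun v => degroot mu v p q) (1 - risk_slope mu p q w).
Proof.
move=> w12; have w01 : 0 < w < 1 by lra.
apply: (@near_eq_is_derive _ _ _ (fun v => v - bayes_risk mu p q v)).
  have : \forall v \near w, v \in `]0, (1/2)[.
    by apply: near_in_itvoo; rewrite in_itv.
  apply: filterS => v; rewrite in_itv/= => v12.
  rewrite degrootE//; last by lra.
  by rewrite (min_idPl _)//; lra.
apply: is_deriveB; exact: bayes_risk_derive.
Qed.

Lemma degroot_derive_gt w : 1/2 < w < 1 ->
  is_derive w 1 (fun v => degroot mu v p q) (- 1 - risk_slope mu p q w).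
Proof.
move=> w12; have w01 : 0 < w < 1 by lra.
apply: (@near_eq_is_derive _ _ _ (fun v => (1 - v) - bayes_risk mu p q v)).
  have : \forall v \near w, v \in `](1/2), 1[.
    by apply: near_in_itvoo; rewrite in_itv.
  apply: filterS => v; rewrite in_itv/= => v12.
  rewrite degrootE//; last by lra.
  by rewrite (min_idPr _)//; lra.
by rewrite -[- 1]add0r; apply: is_deriveB; exact: bayes_risk_derive.
Qed.

Lemma derive1_degroot_lt w : 0 < w < 1/2 ->
  derive1 (fun v => degroot mu v p q) w = 1 - risk_slope mu p q w.
Proof.
move=> w12; rewrite derive1E.
by have D := degroot_derive_lt w12; exact: derive_val.
Qed.

Lemma derive1_degroot_gt w : 1/2 < w < 1 ->
  derive1 (fun v => degroot mu v p q) w = - 1 - risk_slope mu p q w.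
Proof.
move=> w12; rewrite derive1E.
by have D := degroot_derive_gt w12; exact: derive_val.
Qed.

Lemma cvg_derive1_degroot_lt w : 0 < w < 1/2 ->
  derive1 (fun v => degroot mu v p q) v @[v --> w] -->
  derive1 (fun v => degroot mu v p q) w.
Proof.
move=> w12; rewrite derive1_degroot_lt//.
have E : \forall v \near w,
    1 - risk_slope mu p q v = derive1 (fun v => degroot mu v p q) v.
  have : \forall v \near w, v \in `]0, (1/2)[.
    by apply: near_in_itvoo; rewrite in_itv.
  by apply: filterS => v; rewrite in_itv/= => v12; rewrite derive1_degroot_lt.
apply: cvg_trans; first exact: near_eq_cvg E.
by apply: cvgB; [exact: cvg_cst|apply: cvg_risk_slope; lra].
Qed.

Lemma cvg_derive1_degroot_gt w : 1/2 < w < 1 ->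
  derive1 (fun v => degroot mu v p q) v @[v --> w] -->
  derive1 (fun v => degroot mu v p q) w.
Proof.
move=> w12; rewrite derive1_degroot_gt//.
have E : \forall v \near w,
    - 1 - risk_slope mu p q v = derive1 (fun v => degroot mu v p q) v.
  have : \forall v \near w, v \in `](1/2), 1[.
    by apply: near_in_itvoo; rewrite in_itv.
  by apply: filterS => v; rewrite in_itv/= => v12; rewrite derive1_degroot_gt.
apply: cvg_trans; first exact: near_eq_cvg E.
by apply: cvgB; [exact: cvg_cst|apply: cvg_risk_slope; lra].
Qed.

(** [risk_slope] is continuous across one half, so the one-sided limits differ only through the
    corner of [Num.min w (1 - w)]. *)
Lemma cvg_derive1_degroot_left :
  derive1 (fun v => degroot mu v p q) w @[w --> (1/2)^'-] -->
  1 - risk_slope mu p q (1/2).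
Proof.
have E : \forall w \near (1/2 : R)^'-,
    1 - risk_slope mu p q w = derive1 (fun v => degroot mu v p q) w.
  near=> w; rewrite derive1_degroot_lt//; apply/andP; split.
    by near: w; apply: nbhs_left_gt; lra.
  by near: w; exact: nbhs_left_lt.
apply: cvg_trans; first exact: near_eq_cvg E.
apply: cvgB; first exact: cvg_cst.
by apply: cvg_at_left_filter; apply: cvg_risk_slope; lra.
Unshelve. all: by end_near. Qed.

Lemma cvg_derive1_degroot_right :
  derive1 (fun v => degroot mu v p q) w @[w --> (1/2)^'+] -->
  - 1 - risk_slope mu p q (1/2).
Proof.
have E : \forall w \near (1/2 : R)^'+,
    - 1 - risk_slope mu p q w = derive1 (fun v => degroot mu v p q) w.
  near=> w; rewrite derive1_degroot_gt//; apply/andP; split.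
    by near: w; exact: nbhs_right_gt.
  by near: w; apply: nbhs_right_lt; lra.
apply: cvg_trans; first exact: near_eq_cvg E.
apply: cvgB; first exact: cvg_cst.
by apply: cvg_at_right_filter; apply: cvg_risk_slope; lra.
Unshelve. all: by end_near. Qed.

End atomless.

(** * Thresholds as log-odds, and determination of the cdf *)

Lemma logb_odds_surj (R : realType) (b x : R) : 1 < b ->
  exists2 w, 0 < w < 1 & x = logb b ((1 - w) / w).
Proof.
move=> b1; have lnb : ln b != 0 by rewrite gt_eqF// ln_gt0.
(* Here [e] is b to the power [x]; solving [(1 - w) / w = e] gives the witness [(1 + e)^-1]. *)
have e0 := expR_gt0 (x * ln b); set e := expR _ in e0.
have e1 : 0 < 1 + e by rewrite addr_gt0.
exists (1 + e)^-1.
  by rewrite invr_gt0 e1 invf_lt1// ltrDl.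
have -> : (1 - (1 + e)^-1) / (1 + e)^-1 = e by field; rewrite gt_eqF.
by rewrite /logb expRK mulfK.
Qed.

Lemma logb_odds_ge0 (R : realType) (b w : R) : 1 < b -> 0 < w < 1 ->
  (0 <= logb b ((1 - w) / w)) = (w <= 1/2).
Proof.
move=> b1 /andP[w0 w1]; rewrite /logb pmulr_lge0 ?invr_gt0 ?ln_gt0//.
rewrite -[in LHS]ln1 ler_ln ?posrE ?divr_gt0 ?subr_gt0//.
by rewrite ler_pdivlMr//; apply/idP/idP; lra.
Qed.

Section determination.
Context {R : realType} {b : R}.
Context {d} {T : measurableType d} {mu : {measure set T -> \bar R}}.
Context {d'} {T' : measurableType d'} {mu' : {measure set T' -> \bar R}}.
Context {p q : T -> R} {p' q' : T' -> R}.
Hypotheses (b1 : 1 < b) (dp : prob_density mu p) (dq : prob_density mu q).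
Hypotheses (dp' : prob_density mu' p') (dq' : prob_density mu' q').
Hypothesis noatom : forall x : R,
  prob_of mu p [set t | info_dens b p q t = x%:E] = 0%E.
Hypothesis noatom' : forall x : R,
  prob_of mu' p' [set t | info_dens b p' q' t = x%:E] = 0%E.

Lemma region_prob_eq (w : R) : 0 < w < 1 ->
  degroot mu' w p' q' = degroot mu w p q ->
  risk_slope mu' p' q' w = risk_slope mu p q w ->
  region_prob mu' p' q' w = region_prob mu p q w.
Proof.
by move=> w01; rewrite !degrootE// !region_probE// => /addrI/oppr_inj -> ->.
Qed.

(** Derivatives are local, so agreement on an open interval passes to them. *)
Lemma derive1_degroot_eq (u v : R) :
  {in `]u, v[, forall w, degroot mu' w p' q' = degroot mu w p q} ->
  {in `]u, v[, forall w, derive1 (fun x => degroot mu' x p' q') w =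
                         derive1 (fun x => degroot mu x p q) w}.
Proof.
move=> degE w wuv; rewrite !derive1E; apply: near_eq_derive.
by have := near_in_itvoo wuv; apply: filterS => x /degE.
Qed.

Lemma cdf_info_eq_ge0 :
  (forall w : R, 0 < w <= 1/2 -> degroot mu' w p' q' = degroot mu w p q) ->
  forall x : R, 0 <= x -> cdf_info b mu' p' q' x = cdf_info b mu p q x.
Proof.
move=> degE x; have [w w01 ->] := logb_odds_surj x b1.
rewrite logb_odds_ge0// !cdf_infoE// => w2.
have D1E : {in `]0, (1/2)[, forall w, derive1 (fun x => degroot mu' x p' q') w =
                         derive1 (fun x => degroot mu x p q) w}.
  by apply: derive1_degroot_eq => v; rewrite in_itv/= => v12; apply: degE; lra.
apply: region_prob_eq => //; first by apply: degE; lra.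
(* At [w = 1/2], that is at threshold 0, the informations are known to agree only on the left; the
   slopes are identified by uniqueness of the left limits of the derivatives. *)
move: w2; rewrite le_eqVlt => /orP[/eqP ->|w2].
  suff : 1 - risk_slope mu' p' q' (1/2) = 1 - risk_slope mu p q (1/2) by lra.
  have L := cvg_derive1_degroot_left b1 dp dq noatom.
  have L' := cvg_derive1_degroot_left b1 dp' dq' noatom'.
  apply: (cvg_unique _ L') => //.
  apply: cvg_trans L; apply: near_eq_cvg.
  near=> v; apply/esym/D1E; rewrite in_itv/=; apply/andP; split.
    by near: v; apply: nbhs_left_gt; lra.
  by near: v; exact: nbhs_left_lt.
have w12 : 0 < w < 1/2 by lra.
have := D1E w; rewrite in_itv/= w12 => /(_ isT).
by rewrite !(derive1_degroot_lt (b := b))//; lra.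
Unshelve. all: by end_near. Qed.

Lemma cdf_info_eq_lt0 :
  (forall w : R, 1/2 < w < 1 -> degroot mu' w p' q' = degroot mu w p q) ->
  forall x : R, x < 0 -> cdf_info b mu' p' q' x = cdf_info b mu p q x.
Proof.
move=> degE x; have [w w01 ->] := logb_odds_surj x b1.
rewrite ltNge logb_odds_ge0// -ltNge !cdf_infoE// => w2.
have w12 : 1/2 < w < 1 by lra.
apply: region_prob_eq => //; first exact: degE.
have := @derive1_degroot_eq (1/2) 1 _ w; rewrite in_itv/= w12.
rewrite !(derive1_degroot_gt (b := b))// => H.
suff : - 1 - risk_slope mu' p' q' w = - 1 - risk_slope mu p q w by lra.
by apply: H => // v; rewrite in_itv/= => v12; exact: degE.
Qed.

End determination.

Unset Implicit Arguments.

Theorem theorem4 (R : realType) (d : measure_display) (T : measurableType d)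
  (b : R) (mu : {measure set T -> \bar R}) (p q : T -> R) :
  1 < b ->
  prob_density mu p -> prob_density mu q ->
  (forall x : R, prob_of mu p [set t | info_dens b p q t = x%:E] = 0%E) ->
  let I := fun w : R => degroot mu w p q in
  let F := cdf_info b mu p q in
  (* (a) *)
  (forall w : R, 0 < w < 1 -> w != 1/2 ->
     derivable I w 1 /\ {for w, continuous (derive1 I)}) /\
  (forall w : R, 0 < w < 1/2 -> 0 <= (derive1 I) w) /\
  (forall w : R, 1/2 < w < 1 -> (derive1 I) w <= 0) /\
  (exists Lm Lp : R,
     (derive1 I) x @[x --> (1/2)^'-] --> Lm /\
     (derive1 I) x @[x --> (1/2)^'+] --> Lp /\
     Lm - Lp = 2 /\
  (* (b), at 0 *)
     F 0 = - I (1/2) - Lp / 2) /\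
  (* (b) *)
  (forall w : R, 0 < w < 1/2 ->
     F (logb b ((1 - w) / w)) = 1 - I w - (1 - w) * (derive1 I) w) /\
  (forall w : R, 1/2 < w < 1 ->
     F (logb b ((1 - w) / w)) = - I w - (1 - w) * (derive1 I) w) /\
  (* (c) *)
  (forall (d' : measure_display) (T' : measurableType d')
          (mu' : {measure set T' -> \bar R}) (p' q' : T' -> R),
     prob_density mu' p' -> prob_density mu' q' ->
     (forall x : R, prob_of mu' p' [set t | info_dens b p' q' t = x%:E] = 0%E) ->
     ((forall w : R, 0 < w <= 1/2 -> degroot mu' w p' q' = I w) ->
        forall x : R, 0 <= x -> cdf_info b mu' p' q' x = F x) /\
     ((forall w : R, 1/2 < w < 1 -> degroot mu' w p' q' = I w) ->
        forall x : R, x < 0 -> cdf_info b mu' p' q' x = F x)).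
Proof.
move=> b1 dp dq noatom; cbv zeta.
(* Threshold 0 is the log-odds of one half. *)
have cdf0 : cdf_info b mu p q 0 = region_prob mu p q (1/2).
  rewrite -(cdf_infoE dp dq b1); last by lra.
  congr (cdf_info b mu p q _).
  have -> : (1 - 1/2) / (1/2) = 1 :> R by field.
  by rewrite /logb ln1 mul0r.
(* A and B lie in [0, 1], so the slope A - B lies in [-1, 1]; this yields both signs in (a). *)
have slope1 w : 0 <= 1 - risk_slope mu p q w /\ - 1 - risk_slope mu p q w <= 0.
  have mS := measurable_region dp dq w.
  have := prob_density_Rintegral_le1 dp mS.
  have := prob_density_Rintegral_le1 dq (measurableC mS).
  by rewrite /risk_slope /region_prob /regionC_prob => h1 h2; split; lra.
split; [|split; [|split; [|split; [|split; [|split]]]]].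
- move=> w w01 w2; have := w2; rewrite neq_lt => /orP[w12|w12].
    have {}w12 : 0 < w < 1/2 by lra.
    have D := degroot_derive_lt b1 dp dq noatom w12.
    by split; [exact: ex_derive|exact: (cvg_derive1_degroot_lt b1)].
  have {}w12 : 1/2 < w < 1 by lra.
  have D := degroot_derive_gt b1 dp dq noatom w12.
  by split; [exact: ex_derive|exact: (cvg_derive1_degroot_gt b1)].
- by move=> w w12; rewrite (derive1_degroot_lt b1)//; case: (slope1 w).
- by move=> w w12; rewrite (derive1_degroot_gt b1)//; case: (slope1 w).
(* The witnesses are the one-sided limits of the derivative; the common slope cancels in their
   difference. *)
- exists (1 - risk_slope mu p q (1/2)), (- 1 - risk_slope mu p q (1/2)).
  split; first exact: (cvg_derive1_degroot_left b1).
  split; first exact: (cvg_derive1_degroot_right b1).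
  split; first lra.
  rewrite cdf0 region_probE; [|by []|by []|by lra].
  rewrite degrootE; [|by []|by []|by lra].
  by rewrite (min_idPl _); lra.
- move=> w w12; have w01 : 0 < w < 1 by lra.
  rewrite (derive1_degroot_lt b1)// cdf_infoE// degrootE// region_probE//.
  by rewrite (min_idPl _); lra.
- move=> w w12; have w01 : 0 < w < 1 by lra.
  rewrite (derive1_degroot_gt b1)// cdf_infoE// degrootE// region_probE//.
  by rewrite (min_idPr _); lra.
- move=> d' T' mu' p' q' dp' dq' noatom'; split.
  + exact: cdf_info_eq_ge0.
  + exact: cdf_info_eq_lt0.
Qed.
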